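(* Let $J_1,J_2$ be either the value functions $J_{\mathcal{R}_1},J_{\mathcal{R}_2}$ of two reward functions in a fixed environment, or the value functions $J_{\mathcal{T}_1},J_{\mathcal{T}_2}$ of two transition models in a fixed task. Let $\Pi$ be a set of stationary policies containing a nonempty open subset of $\Pi^+$, and suppose $J_1,J_2$ are both non-trivial on $\Pi$ and not equivalent on $\Pi$. Then $J_1$ and $J_2$ admit a value inversion on $\Pi$: there exist $\pi,\pi'\in\Pi$ with $J_1(\pi)>J_1(\pi')$ and $J_2(\pi')>J_2(\pi)$.
   Context: Setting: MDPs $(\mathcal{S},\mathcal{A},\mathcal{T},d_0,\mathcal{R},\gamma)$ with finite $\mathcal{S}$, finite $\mathcal{A}$ with $|\mathcal{A}|>1$, $\gamma\in[0,1)$, all states reachable. An environment is an MDP without reward; a task is an MDP without transition model. Stationary policies $\pi:\mathcal{S}\to\Delta(\mathcal{A})$ are identified with $\Delta(\mathcal{A})^{|\mathcal{S}|}\subset\mathbb{R}^{\mathcal{S}\times\mathcal{A}}$; $\Pi^+$ is the set of those with $\pi(a\mid s)>0$ for all $s,a$, and ''open'' means open in $\Pi^+$. $J(\pi)=\mathbb{E}\big[\sum_{t\ge0}\gamma^t\mathcal{R}(s_t,a_t)\big]$ ($s_0\sim d_0$, $a_t\sim\pi(\cdot\mid s_t)$, $s_{t+1}\sim\mathcal{T}(\cdot\mid s_t,a_t)$); $J_{\mathcal{R}}$ denotes this with reward $\mathcal{R}$ in a fixed environment, $J_{\mathcal{T}}$ with transition model $\mathcal{T}$ in a fixed task. $J$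 is trivial on $\Pi$ if constant on $\Pi$; $J_1,J_2$ are equivalent on $\Pi$ if for all $\pi,\pi'\in\Pi$, $J_1(\pi)\ge J_1(\pi')\iff J_2(\pi)\ge J_2(\pi')$. *)

(* Defs.v *)
From HB Require Import structures.
From mathcomp Require Import all_boot all_order all_algebra.
From mathcomp Require Import all_classical all_reals all_analysis.
Set Implicit Arguments. Unset Strict Implicit. Unset Printing Implicit Defensive.
Import Order.TTheory GRing.Theory Num.Theory numFieldNormedType.Exports.
Local Open Scope ring_scope.

Section MDP.
Variables (R : realType) (S A : finType).

Definition is_distr (T : finType) (p : T -> R) : Prop :=
  (forall x, 0 <= p x) /\ \sum_(x : T) p x = 1.

Definition is_policy (pi : S -> A -> R) : Prop := forall s, is_distr (pi s).

Definition is_pos_policy (pi : S -> A -> R) : Prop :=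
  is_policy pi /\ forall s a, 0 < pi s a.

Definition is_transition (T : S -> A -> S -> R) : Prop :=
  forall s a, is_distr (T s a).

Fixpoint state_dist (T : S -> A -> S -> R) (d0 : S -> R) (pi : S -> A -> R)
    (t : nat) : S -> R :=
  match t with
  | 0 => d0
  | t'.+1 => fun s' =>
      \sum_(s : S) \sum_(a : A) state_dist T d0 pi t' s * pi s a * T s a s'
  end.

Definition all_reachable (T : S -> A -> S -> R) (d0 : S -> R) : Prop :=
  forall s, exists pi t, is_policy pi /\ 0 < state_dist T d0 pi t s.

Definition step_reward (T : S -> A -> S -> R) (d0 : S -> R) (gamma : R)
    (Rw : S -> A -> R) (pi : S -> A -> R) (t : nat) : R :=
  gamma ^+ t * \sum_(s : S) \sum_(a : A) state_dist T d0 pi t s * pi s a * Rw s a.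

Definition value (T : S -> A -> S -> R) (d0 : S -> R) (gamma : R)
    (Rw : S -> A -> R) (pi : S -> A -> R) : R :=
  limn (series (step_reward T d0 gamma Rw pi)).

Definition trivial_on (J : (S -> A -> R) -> R) (Pi : (S -> A -> R) -> Prop) :=
  forall pi pi', Pi pi -> Pi pi' -> J pi = J pi'.

Definition equivalent_on (J1 J2 : (S -> A -> R) -> R)
    (Pi : (S -> A -> R) -> Prop) :=
  forall pi pi', Pi pi -> Pi pi' -> (J1 pi' <= J1 pi <-> J2 pi' <= J2 pi).

(* Pi contains a nonempty subset that is open in Pi^+ (topology of
   R^{S x A}, expressed with the sup-norm ball around a point of the set) *)
Definition contains_open_subset (Pi : (S -> A -> R) -> Prop) : Prop :=
  exists U : (S -> A -> R) -> Prop,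
    (exists pi, U pi) /\
    (forall pi, U pi -> is_pos_policy pi) /\
    (forall pi, U pi -> Pi pi) /\
    (forall pi0, U pi0 -> exists eps : R, 0 < eps /\
       forall pi, is_pos_policy pi ->
         (forall s a, `|pi s a - pi0 s a| < eps) -> U pi).

Definition value_inversion (J1 J2 : (S -> A -> R) -> R)
    (Pi : (S -> A -> R) -> Prop) : Prop :=
  exists pi pi', Pi pi /\ Pi pi' /\ J1 pi' < J1 pi /\ J2 pi < J2 pi'.

End MDP.

(* Main.v *)
Require Import Defs.
From HB Require Import structures.
From mathcomp Require Import all_boot all_order all_algebra.
From mathcomp Require Import all_classical all_reals all_analysis.
From mathcomp Require Import ring lra.
Import Order.TTheory GRing.Theory Num.Theory numFieldNormedType.Exports.
Local Open Scope ring_scope.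
Set Implicit Arguments. Unset Strict Implicit. Unset Printing Implicit Defensive.

(* The value of a policy is linear in its discounted occupancy measure, which
   solves a linear system and hence is a rational function of the policy.
   Positive policies [pi] and [rho] are joined by a rational path along which
   [J1] is affine: interpolate the occupancies of the first environment.

   Without value inversion on the open set [U], [J1] determines [J2] on [U]:
   if [J1 p = J1 q] and [J2 p < J2 q], moving [p] up or [q] down in [J1]
   creates an inversion. If [p], [q] are arbitrary positive policies with
   [J1 p = J1 q], join both to a point of [U] by such paths: [J1] agrees along
   them, so [J2] agrees for small times, hence up to the end points because it
   is rational. Thus [J1] and [J2] determine each other on positive policies,
   and by density and the intermediate value theorem on all policies. *)

(** Only times in [0,1] are constrained, since a path need consist of policies only there. One
    zero-free denominator serves the whole interval. *)
Definition rational01 (R : realType) (f : R -> R) : Prop :=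
  exists p q : {poly R}, forall t, 0 <= t <= 1 ->
    q.[t] != 0 /\ f t = p.[t] / q.[t].

(** * Rational functions on the unit interval *)

Section Rational.
Variable R : realType.
Implicit Types f g : R -> R.

Lemma eq_rational01 f g :
  (forall t, 0 <= t <= 1 -> f t = g t) -> rational01 f -> rational01 g.
Proof.
move=> fg [p [q pq]]; exists p, q => t t01.
by have [q0 <-] := pq _ t01; rewrite fg.
Qed.

Lemma rational01_poly (p : {poly R}) : rational01 (horner p).
Proof. by exists p, 1 => t _; rewrite hornerC oner_neq0 divr1. Qed.

Lemma rational01_cst (c : R) : rational01 (fun=> c).
Proof.
by apply: eq_rational01 (rational01_poly c%:P) => t _; rewrite hornerC.
Qed.

Lemma rational01_id : rational01 (fun t : R => t).
Proof. by apply: eq_rational01 (rational01_poly 'X) => t _; rewrite hornerX. Qed.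

Lemma rational01D f g :
  rational01 f -> rational01 g -> rational01 (fun t => f t + g t).
Proof.
move=> [p [q pq]] [p' [q' pq']]; exists (p * q' + p' * q), (q * q') => t t01.
have [q0 ->] := pq _ t01; have [q'0 ->] := pq' _ t01.
by rewrite !(hornerD, hornerM) mulf_neq0 //; split=> //; field; apply/andP.
Qed.

Lemma rational01M f g :
  rational01 f -> rational01 g -> rational01 (fun t => f t * g t).
Proof.
move=> [p [q pq]] [p' [q' pq']]; exists (p * p'), (q * q') => t t01.
have [q0 ->] := pq _ t01; have [q'0 ->] := pq' _ t01.
by rewrite !hornerM mulf_neq0 //; split=> //; field; apply/andP.
Qed.

Lemma rational01V f : (forall t, 0 <= t <= 1 -> f t != 0) ->
  rational01 f -> rational01 (fun t => (f t)^-1).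
Proof.
move=> f0 [p [q pq]]; exists q, p => t t01.
have := f0 _ t01; have [q0 ->] := pq _ t01.
rewrite mulf_eq0 invr_eq0 negb_or => /andP[p0 _].
by rewrite p0 invf_div.
Qed.

Lemma rational01N f : rational01 f -> rational01 (fun t => - f t).
Proof.
move=> /(rational01M (rational01_cst (-1))).
by apply: eq_rational01 => t _; rewrite mulN1r.
Qed.

Lemma rational01B f g :
  rational01 f -> rational01 g -> rational01 (fun t => f t - g t).
Proof. by move=> rf /rational01N; apply: rational01D. Qed.

Lemma rational01_sum (I : Type) (r : seq I) (P : pred I) (F : I -> R -> R) :
  (forall i, P i -> rational01 (F i)) ->
  rational01 (fun t => \sum_(i <- r | P i) F i t).
Proof.
move=> rF; elim: r => [|i r IH].
  by apply: eq_rational01 (rational01_cst 0) => t _; rewrite big_nil.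
case Pi: (P i); last by apply: eq_rational01 IH => t _; rewrite big_cons Pi.
apply: eq_rational01 (rational01D (rF _ Pi) IH) => t _.
by rewrite big_cons Pi.
Qed.

Lemma rational01_prod (I : Type) (r : seq I) (P : pred I) (F : I -> R -> R) :
  (forall i, P i -> rational01 (F i)) ->
  rational01 (fun t => \prod_(i <- r | P i) F i t).
Proof.
move=> rF; elim: r => [|i r IH].
  by apply: eq_rational01 (rational01_cst 1) => t _; rewrite big_nil.
case Pi: (P i); last by apply: eq_rational01 IH => t _; rewrite big_cons Pi.
apply: eq_rational01 (rational01M (rF _ Pi) IH) => t _.
by rewrite big_cons Pi.
Qed.

Lemma rational01_det n (M : R -> 'M[R]_n) :
  (forall i j, rational01 (fun t => M t i j)) ->
  rational01 (fun t => \det (M t)).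
Proof.
move=> rM; apply: rational01_sum => s _.
apply: rational01M; first exact: rational01_cst.
by apply: rational01_prod => i _; apply: rM.
Qed.

(** Cofactor formula; the determinant has no zero on [0,1]. *)
Lemma rational01_invmx n (M : R -> 'M[R]_n) :
  (forall t, 0 <= t <= 1 -> M t \in unitmx) ->
  (forall i j, rational01 (fun t => M t i j)) ->
  forall i j, rational01 (fun t => invmx (M t) i j).
Proof.
move=> uM rM i j.
have rcof : rational01 (fun t => cofactor (M t) j i).
  apply: rational01M; first exact: rational01_cst.
  by apply: rational01_det => k l;
    apply: eq_rational01 (rM (lift j k) (lift i l)) => t _; rewrite !mxE.
have rV : rational01 (fun t => (\det (M t))^-1).
  apply: rational01V (rational01_det rM) => t /uM.
  by rewrite unitmxE unitfE.
apply: eq_rational01 (rational01M rV rcof) => t /uM ut.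
by rewrite /invmx ut !mxE.
Qed.

(** The points [d / k.+1] with [k < size p] are distinct roots, one too many for a nonzero
    polynomial. *)
Lemma poly_eq0_near0 (p : {poly R}) (d : R) : 0 < d ->
  (forall t, 0 <= t <= d -> p.[t] = 0) -> p = 0.
Proof.
move=> d0 pd; pose s := [seq d / k.+1%:R | k <- iota 0 (size p)].
apply: (@roots_geq_poly_eq0 _ p s); last by rewrite size_map size_iota.
  apply/allP => _ /mapP[k _ ->]; apply/rootP/pd.
  rewrite divr_ge0 ?(ltW d0) // ler_pdivrMr ?ltr0Sn // ler_peMr ?(ltW d0) //.
  by rewrite ler1n.
rewrite map_inj_uniq ?iota_uniq // => k l.
move=> /(mulfI (lt0r_neq0 d0)) /invr_inj /eqP.
by rewrite eqr_nat eqSS => /eqP.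
Qed.

(** The numerator of [f - g] vanishes on [0,d], hence is the zero polynomial. *)
Lemma rational01_identity f g (d : R) : rational01 f -> rational01 g ->
  0 < d <= 1 -> (forall t, 0 <= t <= d -> f t = g t) ->
  forall t, 0 <= t <= 1 -> f t = g t.
Proof.
move=> rf rg /andP[d0 d1] fg t t01; apply/eqP; rewrite -subr_eq0; apply/eqP.
have [p [q pq]] := rational01B rf rg.
have [_ ->] := pq _ t01.
rewrite (@poly_eq0_near0 p d) // ?horner0 ?mul0r // => u /andP[u0 ud].
have u01 : 0 <= u <= 1 by rewrite u0 (le_trans ud).
have [q0 /eqP] := pq _ u01.
rewrite fg ?u0 // subrr eq_sym mulf_eq0 invr_eq0 (negbTE q0) orbF.
by move/eqP.
Qed.

Lemma rational01_cvg0 f (e : R) : rational01 f -> 0 < e ->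
  exists2 d, 0 < d <= 1 & forall t, 0 <= t <= d -> `|f t - f 0| < e.
Proof.
move=> [p [q pq]] e0.
have [q0 f0] : q.[0] != 0 /\ f 0 = p.[0] / q.[0] by apply: pq; rewrite lexx ler01.
have : ((fun t => p.[t] / q.[t]) @ (0 : R) --> p.[0] / q.[0])%classic.
  apply: cvgM; first exact: continuous_horner.
  by apply: cvgV => //; exact: continuous_horner.
move=> /cvgrPdist_lt /(_ _ e0) /nbhs_ballP[d /= d0 dP].
(* Halving fits the closed interval into the open ball; the cap at 1 keeps times where [f] is a
   quotient. *)
exists (Num.min (d / 2) 1).
  by rewrite lt_min divr_gt0 //= ltr01 ge_min lexx orbT.
move=> t /andP[t0]; rewrite le_min => /andP[td t1].
have [_ ->] := pq t (introT andP (conj t0 t1)).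
rewrite f0 distrC; apply: dP; rewrite /ball /= sub0r normrN ger0_norm //.
by apply: (le_lt_trans td); rewrite ltr_pdivrMr // ltr_pMr // ltr1n.
Qed.

Lemma rational01_ivt f (m : R) : rational01 f -> f 0 <= m <= f 1 ->
  exists2 t, 0 <= t <= 1 & f t = m.
Proof.
move=> [p [q pq]] /andP[f0m mf1].
(* Multiplying by [q] once more gives a polynomial with the sign of [f - m], whatever the sign of
   [q]. *)
have sgnE t : 0 <= t <= 1 ->
    ((p - m *: q) * q).[t] = (f t - m) * q.[t] ^+ 2.
  by move=> /pq[qt0 ->]; rewrite hornerM hornerD hornerN hornerZ; field.
have [||t t01 /rootP] := @poly_ivt R ((p - m *: q) * q) 0 1; first exact: ler01.
  rewrite !sgnE ?lexx ?ler01 //.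
  by rewrite mulr_le0_ge0 ?subr_le0 ?sqr_ge0 // mulr_ge0 ?subr_ge0 ?sqr_ge0.
rewrite sgnE //; have [qt0 _] := pq _ t01.
move=> /eqP; rewrite mulf_eq0 sqrf_eq0 (negbTE qt0) orbF subr_eq0.
by move=> /eqP; exists t.
Qed.

End Rational.

Definition rational_path (R : realType) (S A : finType) (c : R -> S -> A -> R) :=
  forall s a, rational01 (fun t => c t s a).

Lemma convex_comb_gt0 (R : realType) (t x y : R) :
  0 <= t <= 1 -> 0 < x -> 0 < y -> 0 < (1 - t) * x + t * y.
Proof.
move=> /andP[t0 t1] x0 y0; have [->|tn0] := eqVneq t 0.
  by rewrite subr0 mul1r mul0r addr0.
by rewrite ltr_wpDl ?mulr_ge0 ?subr_ge0 ?(ltW x0) // mulr_gt0 // lt0r tn0.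
Qed.

(** * Discounted occupancy measures *)

Section Value.
Variables (R : realType) (S A : finType).
Variables (T : S -> A -> S -> R) (d0 : S -> R) (gamma : R).
Hypotheses (T_tr : is_transition T) (d0_ge0 : forall s, 0 <= d0 s).
Hypotheses (gamma_ge0 : 0 <= gamma) (gamma_lt1 : gamma < 1).
Implicit Types (pi rho : S -> A -> R) (u x mu : S -> R) (Rw : S -> A -> R).

Definition state_kernel pi (s s' : S) : R := \sum_a pi s a * T s a s'.

(** The discounted flow equation. As a predicate, it lets a mixture of two occupancies be recognised
    as the occupancy of a third policy. *)
Definition is_occupancy pi mu : Prop := forall s',
  mu s' = d0 s' + gamma * \sum_s mu s * state_kernel pi s s'.

Lemma state_kernel_distr pi s : is_policy pi -> is_distr (state_kernel pi s).
Proof.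
move=> /(_ s)[p0 p1]; split=> [s'|].
  by apply: sumr_ge0 => a _; rewrite mulr_ge0 // (T_tr s a).1.
rewrite exchange_big /= -[RHS]p1; apply: eq_bigr => a _.
by rewrite -mulr_sumr (T_tr s a).2 mulr1.
Qed.

Lemma sum_push_forward pi x : is_policy pi ->
  \sum_s' \sum_s x s * state_kernel pi s s' = \sum_s x s.
Proof.
move=> pol; rewrite exchange_big /=; apply: eq_bigr => s _.
by rewrite -mulr_sumr (state_kernel_distr s pol).2 mulr1.
Qed.

(** The kernel preserves total mass, so summing over states bounds the mass of [u] by [gamma] times
    itself. Invertibility, positivity and comparison of supports below all reduce to this. *)
Lemma discounted_subinvariant_eq0 pi u : is_policy pi ->
  (forall s, 0 <= u s) ->
  (forall s', u s' <= gamma * \sum_s u s * state_kernel pi s s') ->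
  forall s, u s = 0.
Proof.
move=> pol u0 sub s; apply: (psumr_eq0P (P := xpredT)) => //.
have le : \sum_s u s <= gamma * \sum_s u s.
  rewrite -{2}(sum_push_forward u pol) mulr_sumr.
  by apply: ler_sum => s' _; apply: sub.
apply/eqP; rewrite eq_le sumr_ge0 // andbT.
have : 0 <= (1 - gamma) * - \sum_s u s by rewrite mulrN mulrBl mul1r opprB subr_ge0.
by rewrite pmulr_rge0 ?subr_gt0 // oppr_ge0.
Qed.

(** The matrix [I - gamma P], with [P] the state kernel of [pi]; occupancies act on it as row
    vectors from the left. *)
Definition resolvent_mx pi : 'M[R]_#|S| :=
  \matrix_(i, j) ((i == j)%:R - gamma * state_kernel pi (enum_val i) (enum_val j)).

Lemma mul_resolvent_mx pi (v : 'rV[R]_#|S|) (j : 'I_#|S|) :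
  (v *m resolvent_mx pi) 0 j =
  v 0 j - gamma * \sum_s v 0 (enum_rank s) * state_kernel pi s (enum_val j).
Proof.
rewrite mxE (reindex_onto enum_rank enum_val) /=; last by move=> i _; rewrite enum_valK.
under eq_bigl do rewrite enum_rankK eqxx.
rewrite mulr_sumr.
under eq_bigr do rewrite mxE enum_rankK mulrBr.
rewrite !sumrB; congr (_ - _); last first.
  by apply: eq_bigr => s _; rewrite mulrCA.
rewrite (bigD1 (enum_val j)) //= enum_valK eqxx mulr1 big1 ?addr0 // => s sj.
rewrite (_ : _ == j = false) ?mulr0 //; apply/negP => /eqP ej.
by rewrite -ej enum_rankK eqxx in sj.
Qed.

(** By the triangle inequality, the absolute values of a left null vector are subinvariant, hence
    zero. *)
Lemma resolvent_mx_unit pi : is_policy pi -> resolvent_mx pi \in unitmx.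
Proof.
move=> pol; rewrite -row_free_unit -kermx_eq0; apply/eqP/row_matrixP => i.
set v := row i _; have v0 : v *m resolvent_mx pi = 0.
  by rewrite /v -row_mul mulmx_ker row0.
pose u s := `|v 0 (enum_rank s)|.
have u0 : forall s, u s = 0.
  apply: (discounted_subinvariant_eq0 pol) => [s|s']; first exact: normr_ge0.
  have /rowP/(_ (enum_rank s')) := v0.
  rewrite mul_resolvent_mx [RHS]mxE => /eqP; rewrite subr_eq0 => /eqP vE.
  rewrite {1}/u vE normrM ger0_norm // ler_wpM2l // enum_rankK.
  apply: le_trans (ler_norm_sum _ _ _) _; apply: ler_sum => s _.
  by rewrite normrM (ger0_norm (proj1 (state_kernel_distr _ pol) _)).
rewrite row0 -/v; apply/rowP => j.
by rewrite [RHS]mxE -[j]enum_valK; apply/normr0_eq0/u0.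
Qed.

(** Defined by a matrix inverse rather than a series, so that rational dependence on the policy can
    be read off. *)
Definition occupancy pi (s : S) : R :=
  ((\row_j d0 (enum_val j)) *m invmx (resolvent_mx pi)) 0 (enum_rank s).

Lemma occupancyP pi : is_policy pi -> is_occupancy pi (occupancy pi).
Proof.
move=> pol s'; set v := (\row_j d0 (enum_val j)) *m invmx (resolvent_mx pi).
have /rowP/(_ (enum_rank s')) : v *m resolvent_mx pi = \row_j d0 (enum_val j).
  by rewrite mulmxKV // resolvent_mx_unit.
rewrite mul_resolvent_mx [RHS]mxE enum_rankK => /eqP; rewrite subr_eq => /eqP.
by [].
Qed.

Lemma rational01_occupancy (c : R -> S -> A -> R) s :
  (forall t, 0 <= t <= 1 -> is_policy (c t)) -> rational_path c ->
  rational01 (fun t => occupancy (c t) s).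
Proof.
move=> pol rc.
have rM i j : rational01 (fun t => resolvent_mx (c t) i j).
  apply: (@eq_rational01 _ (fun t => (i == j)%:R - gamma *
    \sum_a c t (enum_val i) a * T (enum_val i) a (enum_val j))).
    by move=> t _; rewrite mxE.
  apply: rational01B; first exact: rational01_cst.
  apply: rational01M; first exact: rational01_cst.
  apply: rational01_sum => a _.
  by apply: rational01M => //; exact: rational01_cst.
apply: (@eq_rational01 _ (fun t => \sum_j d0 (enum_val j) *
    invmx (resolvent_mx (c t)) j (enum_rank s))).
  by move=> t _; rewrite /occupancy [RHS]mxE; apply: eq_bigr => j _; rewrite mxE.
apply: rational01_sum => j _; apply: rational01M; first exact: rational01_cst.
by apply: rational01_invmx rM _ _ => t t01; apply/resolvent_mx_unit/pol.
Qed.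

(** As [d0] is nonnegative, the negative part of [mu] is subinvariant. *)
Lemma occupancy_ge0 pi mu s : is_policy pi -> is_occupancy pi mu -> 0 <= mu s.
Proof.
move=> pol occ; pose u s := Num.max 0 (- mu s).
suff : u s = 0 by move/max_idPl; rewrite oppr_le0.
apply: (discounted_subinvariant_eq0 pol) => [s1|s']; first by rewrite le_max lexx.
have K0 s1 : 0 <= state_kernel pi s1 s' by apply: (state_kernel_distr s1 pol).1.
rewrite ge_max mulr_ge0 ?sumr_ge0 //=; last first.
  by move=> s1 _; rewrite mulr_ge0 // le_max lexx.
rewrite occ opprD -mulrN -sumrN ler_wnDl ?oppr_le0 // ler_wpM2l //.
by apply: ler_sum => s1 _; rewrite -mulNr ler_wpM2r // le_max lexx orbT.
Qed.

(* The zero set of [mu] is closed under predecessors that carry mass, so the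
   other occupancy restricted to it is subinvariant. *)
Lemma occupancy_support pi rho mu nu s :
  is_pos_policy pi -> is_policy rho -> is_occupancy pi mu ->
  is_occupancy rho nu -> mu s = 0 -> nu s = 0.
Proof.
move=> [pol pos] rpol occ rocc mus0.
pose u s := if mu s == 0 then nu s else 0.
suff : u s = 0 by rewrite /u mus0 eqxx.
have nu0 s1 : 0 <= nu s1 := occupancy_ge0 s1 rpol rocc.
have mu0 s1 : 0 <= mu s1 := occupancy_ge0 s1 pol occ.
have u0 s1 : 0 <= u s1 by rewrite /u; case: ifP.
have K0 p s1 s2 : is_policy p -> 0 <= state_kernel p s1 s2.
  by move=> pp; apply: (state_kernel_distr s1 pp).1.
apply: (discounted_subinvariant_eq0 rpol) => // s'.
have S0 p x : is_policy p -> (forall s, 0 <= x s) ->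
    0 <= \sum_s x s * state_kernel p s s'.
  by move=> pp x0; apply: sumr_ge0 => s1 _; rewrite mulr_ge0 // K0.
rewrite {1}/u; case: eqP => [mus'|_]; last by rewrite mulr_ge0 // S0.
have /eqP := occ s'; rewrite mus' eq_sym paddr_eq0 ?mulr_ge0 ?S0 //.
move=> /andP[/eqP d00 gS]; rewrite rocc d00 add0r.
have [->|g0] := eqVneq gamma 0; first by rewrite !mul0r.
rewrite ler_wpM2l //; apply: ler_sum => s1 _; rewrite /u.
case: eqP => // /eqP mus1; rewrite mul0r.
move: gS; rewrite mulf_eq0 (negbTE g0) /= => /eqP /psumr_eq0P.
move=> /(_ (fun s _ => mulr_ge0 (mu0 s) (K0 pi s s' pol)) s1 isT) /eqP.
rewrite mulf_eq0 (negbTE mus1) /= => /eqP /psumr_eq0P Ka.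
rewrite [X in _ * X]big1 ?mulr0 // => a _.
(* Full support of [pi] enters here: no action leads from [s1] to [s'], so [rho] cannot make that
   move either. *)
have /eqP : pi s1 a * T s1 a s' = 0.
  apply: Ka => // b _; rewrite mulr_ge0 ?(ltW (pos _ _)) //.
  exact: (T_tr s1 b).1.
by rewrite mulf_eq0 (negbTE (lt0r_neq0 (pos _ _))) /= => /eqP ->; rewrite mulr0.
Qed.

(** * Convergence of the discounted reward series *)

Definition truncated_occupancy pi n s : R :=
  \sum_(0 <= k < n) gamma ^+ k * state_dist T d0 pi k s.

Lemma truncated_occupancyS pi n s' :
  truncated_occupancy pi n.+1 s' =
  d0 s' + gamma * \sum_s truncated_occupancy pi n s * state_kernel pi s s'.
Proof.
rewrite /truncated_occupancy big_nat_recl // expr0 mul1r; congr (_ + _).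
under [in RHS]eq_bigr do rewrite mulr_suml.
rewrite exchange_big /= mulr_sumr; apply: eq_bigr => k _.
rewrite exprS -mulrA; congr (_ * _); rewrite mulr_sumr; apply: eq_bigr => s _.
rewrite -mulrA; congr (_ * _); rewrite mulr_sumr.
by apply: eq_bigr => a _; rewrite mulrA.
Qed.

(** In the difference of the two recursions [d0] cancels, and each step contracts the l1 norm by
    [gamma]. *)
Lemma truncated_occupancy_dist pi mu n : is_policy pi -> is_occupancy pi mu ->
  \sum_s `|mu s - truncated_occupancy pi n s| <= gamma ^+ n * \sum_s `|mu s|.
Proof.
move=> pol occ; elim: n => [|n IH].
  rewrite expr0 mul1r; apply: ler_sum => s _.
  by rewrite /truncated_occupancy big_geq // subr0.
rewrite exprS -mulrA; apply: le_trans (ler_wpM2l gamma_ge0 IH).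
rewrite -(sum_push_forward (fun s => `|mu s - truncated_occupancy pi n s|) pol).
rewrite mulr_sumr; apply: ler_sum => s' _.
rewrite truncated_occupancyS {1}occ opprD addrACA subrr add0r -mulrBr -sumrB.
rewrite normrM ger0_norm // ler_wpM2l //.
apply: le_trans (ler_norm_sum _ _ _) _; apply: ler_sum => s _.
by rewrite -mulrBl normrM (ger0_norm (proj1 (state_kernel_distr _ pol) _)).
Qed.

Lemma series_step_reward Rw pi n :
  series (step_reward T d0 gamma Rw pi) n =
  \sum_s truncated_occupancy pi n s * \sum_a pi s a * Rw s a.
Proof.
rewrite /series /= /truncated_occupancy.
under [RHS]eq_bigr do rewrite mulr_suml.
rewrite [RHS]exchange_big /=; apply: eq_bigr => k _.
rewrite /step_reward mulr_sumr; apply: eq_bigr => s _.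
rewrite -mulrA; congr (_ * _); rewrite mulr_sumr.
by apply: eq_bigr => a _; rewrite mulrA.
Qed.

Lemma value_occupancy Rw pi mu : is_policy pi -> is_occupancy pi mu ->
  value T d0 gamma Rw pi = \sum_s mu s * \sum_a pi s a * Rw s a.
Proof.
move=> pol occ; set L := RHS; apply/cvg_lim => //.
(* The l1 error of the truncated occupancy, times a crude bound on every expected reward, gives a
   geometric error. *)
pose C := (\sum_s `|mu s|) * \sum_s `|\sum_a pi s a * Rw s a|.
have bound n : `|L - series (step_reward T d0 gamma Rw pi) n| <= geometric C gamma n.
  rewrite series_step_reward -sumrB; apply: le_trans (ler_norm_sum _ _ _) _.
  rewrite /= /C mulrC mulrA.
  apply: le_trans (ler_wpM2r _ (truncated_occupancy_dist n pol occ)); last first.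
    exact: sumr_ge0.
  rewrite mulr_suml; apply: ler_sum => s _; rewrite -mulrBl normrM ler_wpM2l //.
  by rewrite (bigD1 s) //= lerDl sumr_ge0.
have g1 : `|gamma| < 1 by rewrite ger0_norm.
apply/cvgrPdist_lt => e e0.
have /cvgrPdist_lt /(_ _ e0) := cvg_geometric C g1.
apply: filterS => n; rewrite sub0r normrN => /(le_lt_trans (ler_norm _)).
exact: le_lt_trans.
Qed.

(** * The value along paths of policies *)

Lemma rational01_value Rw (c : R -> S -> A -> R) :
  (forall t, 0 <= t <= 1 -> is_policy (c t)) -> rational_path c ->
  rational01 (fun t => value T d0 gamma Rw (c t)).
Proof.
move=> pol rc; apply: (@eq_rational01 _ (fun t =>
    \sum_s occupancy (c t) s * \sum_a c t s a * Rw s a)).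
  by move=> t /pol polt; rewrite (value_occupancy _ polt (occupancyP polt)).
apply: rational01_sum => s _; apply: rational01M.
  exact: rational01_occupancy.
apply: rational01_sum => a _; apply: rational01M => //; exact: rational01_cst.
Qed.

(* Mix the state-action occupancies linearly and normalise; states of zero
   occupancy get weight 1. *)
Lemma value_affine_path Rw pi rho : is_pos_policy pi -> is_pos_policy rho ->
  exists c, [/\ c 0 = pi, c 1 = rho,
    forall t, 0 <= t <= 1 -> is_pos_policy (c t), rational_path c &
    forall t, 0 <= t <= 1 -> value T d0 gamma Rw (c t) =
      (1 - t) * value T d0 gamma Rw pi + t * value T d0 gamma Rw rho].
Proof.
move=> ppi prho; have [pol pos] := ppi; have [rpol rpos] := prho.
have occ := occupancyP pol; have rocc := occupancyP rpol.
set mu := occupancy pi in occ; set nu := occupancy rho in rocc.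
pose w s := if mu s == 0 then 1 else mu s.
pose z s := if nu s == 0 then 1 else nu s.
have w0 s : 0 < w s.
  by rewrite /w; case: eqP => // /eqP m0; rewrite lt0r m0 (occupancy_ge0 _ pol occ).
have z0 s : 0 < z s.
  by rewrite /z; case: eqP => // /eqP m0; rewrite lt0r m0 (occupancy_ge0 _ rpol rocc).
pose D t s := (1 - t) * w s + t * z s.
have D0 t s : 0 <= t <= 1 -> 0 < D t s.
  by move=> t01; apply: convex_comb_gt0.
pose c t s a := ((1 - t) * w s * pi s a + t * z s * rho s a) / D t s.
have cpos t : 0 <= t <= 1 -> is_pos_policy (c t).
  move=> t01; have Dt s := D0 t s t01.
  have c0 s a : 0 < c t s a.
    by rewrite divr_gt0 // -!mulrA convex_comb_gt0 ?mulr_gt0.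
  split=> // s; split=> [a|]; first exact: ltW.
  rewrite -mulr_suml big_split /= -!mulr_sumr (pol s).2 (rpol s).2 !mulr1.
  exact: (divff (lt0r_neq0 (Dt s))).
exists c; split=> //.
- apply/funext => s; apply/funext => a; rewrite /c /D subr0 !mul1r !mul0r !addr0.
  by field; rewrite lt0r_neq0.
- apply/funext => s; apply/funext => a; rewrite /c /D subrr !mul1r !mul0r !add0r.
  by field; rewrite lt0r_neq0.
- have rt := @rational01_id R; have rc := @rational01_cst R.
  have rt' : rational01 (fun t : R => 1 - t) by apply: rational01B.
  move=> s a; apply: rational01M; last apply: rational01V.
  + by apply: rational01D; apply: rational01M => //; apply: rational01M.
  + by move=> t t01; rewrite lt0r_neq0 // D0.
  + by apply: rational01D; apply: rational01M.
move=> t t01; have [polt _] := cpos t t01.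
pose x s := (1 - t) * mu s + t * nu s.
(* If both occupancies vanish at [s], both sides are 0 despite the default weights. Exactly one
   vanishing is excluded by equality of supports. Otherwise [x s] is the normaliser [D t s]. *)
have xc s a : x s * c t s a = (1 - t) * mu s * pi s a + t * nu s * rho s a.
  have := D0 t s t01; rewrite /x /c /D /w /z.
  case: (eqVneq (mu s) 0) => m0; case: (eqVneq (nu s) 0) => n0.
  - by rewrite m0 n0 !(mulr0, mul0r, addr0).
  - by rewrite (occupancy_support ppi rpol occ rocc m0) eqxx in n0.
  - by rewrite (occupancy_support prho pol rocc occ n0) eqxx in m0.
  - by move=> /lt0r_neq0 Dn; field.
(* Taking transitions for [f] gives the flow equation for [x]; taking [Rw] gives the affine
   value. *)
have xE (f : S -> A -> R) s : x s * (\sum_a c t s a * f s a) =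
    (1 - t) * (mu s * \sum_a pi s a * f s a) + t * (nu s * \sum_a rho s a * f s a).
  rewrite !mulr_sumr -big_split /=; apply: eq_bigr => a _.
  by rewrite [LHS]mulrA xc; ring.
have xocc : is_occupancy (c t) x.
  move=> s'; rewrite /state_kernel.
  under eq_bigr do rewrite (xE (fun s a => T s a s')).
  rewrite big_split /= -!mulr_sumr /x occ rocc /state_kernel.
  ring.
rewrite (value_occupancy _ polt xocc) (value_occupancy _ pol occ).
rewrite (value_occupancy _ rpol rocc).
under eq_bigr do rewrite xE.
by rewrite big_split /= -!mulr_sumr.
Qed.

End Value.

(** * Inversions for abstract functions of the policy *)

Section Inversion.
Variables (R : realType) (S A : finType).
Implicit Types (J : (S -> A -> R) -> R) (p q pi rho : S -> A -> R).
Implicit Types (U Pi : (S -> A -> R) -> Prop).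

(** This property and the next are all that the argument uses about a value function, so changes of
    reward and of transition model are treated alike. *)
Definition policy_rational J : Prop :=
  forall c : R -> S -> A -> R, (forall t, 0 <= t <= 1 -> is_policy (c t)) ->
  rational_path c -> rational01 (fun t => J (c t)).

(** The path may depend on [J]: where [J1] is affine, [J2] is only known to be rational. *)
Definition policy_linearizable J : Prop :=
  forall pi rho, is_pos_policy pi -> is_pos_policy rho ->
  exists c, [/\ c 0 = pi, c 1 = rho,
    forall t, 0 <= t <= 1 -> is_pos_policy (c t), rational_path c &
    forall t, 0 <= t <= 1 -> J (c t) = (1 - t) * J pi + t * J rho].

Definition relatively_open U : Prop := forall pi0, U pi0 ->
  exists eps : R, 0 < eps /\ forall pi, is_pos_policy pi ->
    (forall s a, `|pi s a - pi0 s a| < eps) -> U pi.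

Definition determines J1 J2 Pi : Prop :=
  forall p q, Pi p -> Pi q -> J1 p = J1 q -> J2 p = J2 q.

Lemma value_inversionC J1 J2 Pi : value_inversion J1 J2 Pi -> value_inversion J2 J1 Pi.
Proof. by move=> [p [q [Pp [Pq [lt1 lt2]]]]]; exists q, p. Qed.

(** * Small times along paths and approximation by positive policies *)

Lemma near0_finite (I : finType) (P : I -> R -> Prop) :
  (forall i, exists2 d, 0 < d <= 1 & forall t, 0 <= t <= d -> P i t) ->
  exists2 d, 0 < d <= 1 & forall t, 0 <= t <= d -> forall i, P i t.
Proof.
move=> Pd; pose d i := s2val (cid2 (Pd i)).
exists (\big[Num.min/1]_i d i).
  apply/andP; split; last by apply: bigmin_le_id.
  by apply/bigmin_gtP; split=> // i _; rewrite /d; case: cid2 => /= e /andP[].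
move=> t /andP[t0 td] i; have : 0 <= t <= d i.
  by rewrite t0 (le_trans td) //; apply: bigmin_le_cond.
by rewrite /d; case: cid2 => /= e _; apply.
Qed.

Lemma near0_and (P Q : R -> Prop) :
  (exists2 d, 0 < d <= 1 & forall t, 0 <= t <= d -> P t) ->
  (exists2 d, 0 < d <= 1 & forall t, 0 <= t <= d -> Q t) ->
  exists2 d, 0 < d <= 1 & forall t, 0 <= t <= d -> P t /\ Q t.
Proof.
move=> [d /andP[d0 d1] Pd] [e /andP[e0 e1] Qe]; exists (Num.min d e).
  by rewrite lt_min d0 e0 ge_min d1.
move=> t /andP[t0]; rewrite le_min => /andP[td te].
by split; [apply: Pd|apply: Qe]; rewrite t0.
Qed.

Lemma relatively_open_path U c : relatively_open U -> rational_path c ->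
  (forall t, 0 <= t <= 1 -> is_pos_policy (c t)) -> U (c 0) ->
  exists2 d, 0 < d <= 1 & forall t, 0 <= t <= d -> U (c t).
Proof.
move=> oU rc cpos /oU[eps [eps0 epsU]].
have [d /andP[d0 d1] dP] :
    exists2 d, 0 < d <= 1 & forall t, 0 <= t <= d ->
    forall i : S * A, `|c t i.1 i.2 - c 0 i.1 i.2| < eps.
  by apply: near0_finite => i; apply: (rational01_cvg0 (rc i.1 i.2)).
exists d; first by rewrite d0.
move=> t td; apply: epsU => [|s a]; last exact: (dP _ td (s, a)).
by apply: cpos; move/andP: td => [-> td]; apply: le_trans td d1.
Qed.

(** The segment from [p] to [pi0] consists of positive policies after time 0, and both functions are
    continuous along it at 0. *)
Lemma pos_policy_approx J1 J2 p pi0 (e : R) :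
  policy_rational J1 -> policy_rational J2 -> is_policy p -> is_pos_policy pi0 ->
  0 < e -> exists2 q, is_pos_policy q & `|J1 q - J1 p| < e /\ `|J2 q - J2 p| < e.
Proof.
move=> r1 r2 pp [pi0p pi0pos] e0.
pose c t s a : R := (1 - t) * p s a + t * pi0 s a.
have cpol t : 0 <= t <= 1 -> is_policy (c t).
  move=> /andP[t0 t1] s; split=> [a|].
    by rewrite addr_ge0 // mulr_ge0 ?subr_ge0 // ?(pp s).1 ?(pi0p s).1.
  by rewrite big_split /= -!mulr_sumr (pp s).2 (pi0p s).2 !mulr1 subrK.
have rc : rational_path c.
  move=> s a; have rt := @rational01_id R; have rcst := @rational01_cst R.
  by apply: rational01D; apply: rational01M => //; apply: rational01B.
have c0 : c 0 = p.
  by apply/funext => s; apply/funext => a; rewrite /c subr0 mul1r mul0r addr0.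
have [d /andP[d0 d1] dP] :=
  near0_and (rational01_cvg0 (r1 _ cpol rc) e0) (rational01_cvg0 (r2 _ cpol rc) e0).
have dd : 0 <= d <= d by rewrite lexx ltW.
exists (c d); last by have := dP _ dd; rewrite c0.
split=> [|s a]; first by apply: cpol; rewrite ltW.
by rewrite ltr_wpDl // ?mulr_gt0 // mulr_ge0 ?subr_ge0 ?(pp s).1.
Qed.

(** Some policy in [Pi] misses the value [m]; a positive policy approximating it within that gap
    misses it too. *)
Lemma nontrivial_pos_policy J Pi pi0 (m : R) :
  policy_rational J -> (forall pi, Pi pi -> is_policy pi) -> is_pos_policy pi0 ->
  ~ trivial_on J Pi -> exists2 rho, is_pos_policy rho & J rho != m.
Proof.
move=> rJ hPi pos0 ntriv.
have [p Pp Jp] : exists2 p, Pi p & J p != m.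
  apply: contrapT => no; apply: ntriv => p q Pp Pq.
  have Jm r : Pi r -> J r = m.
    by move=> Pr; apply: contrapT => /eqP Jr; apply: no; exists r.
  by rewrite !Jm.
have e0 : 0 < `|J p - m| by rewrite normr_gt0 subr_eq0.
have [q qpos [qe _]] := pos_policy_approx rJ rJ (hPi _ Pp) pos0 e0.
exists q => //; apply: contraTneq qe => ->.
by rewrite distrC ltxx.
Qed.

(** * Each function determines the other *)

Lemma determines_open J1 J2 U :
  policy_rational J2 -> policy_linearizable J1 ->
  (forall pi, U pi -> is_pos_policy pi) -> relatively_open U ->
  (forall m, exists2 rho, is_pos_policy rho & J1 rho != m) ->
  ~ value_inversion J1 J2 U -> determines J1 J2 U.
Proof.
move=> r2 lin1 Upos oU ntriv ninv.
suff lt_false p q : U p -> U q -> J1 p = J1 q -> J2 p < J2 q -> False.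
  move=> p q Up Uq J1E; apply/eqP.
  by case: ltgtP => // J2lt; [case: (lt_false p q)|case: (lt_false q p)].
(* [rho] need not lie in [U]: it gives a direction in which [J1] changes at a nonzero constant
   rate. *)
move=> Up Uq J1E J2lt; have [rho rpos] := ntriv (J1 p).
have gap : 0 < J2 q - J2 p by rewrite subr_gt0.
rewrite neq_lt => /orP[J1lt|J1gt].
(* Here [rho] has smaller [J1]: a short move of [q] towards it brings [J1] below [J1 p] and keeps
   [J2] above [J2 p]. *)
- have [c [c0 c1 cpos rc cJ]] := lin1 _ _ (Upos _ Uq) rpos.
  have cpol t : 0 <= t <= 1 -> is_policy (c t) by move=> /cpos[].
  have Uc0 : U (c 0) by rewrite c0.
  have [d /andP[d0 d1] dP] := near0_and (relatively_open_path oU rc cpos Uc0)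
    (rational01_cvg0 (r2 _ cpol rc) gap).
  have dd : 0 <= d <= d by rewrite lexx ltW.
  have [Ud] := dP _ dd; rewrite c0 ltr_norml => /andP[Jd _].
  apply: ninv; exists p, (c d); split; [|split; [|split]] => //; last by lra.
  rewrite cJ ?d1 ?andbT ?ltW // -J1E; nra.
(* Here [rho] has larger [J1]: a short move of [p] raises [J1] above [J1 q] and keeps [J2] below
   [J2 q]. *)
have [c [c0 c1 cpos rc cJ]] := lin1 _ _ (Upos _ Up) rpos.
have cpol t : 0 <= t <= 1 -> is_policy (c t) by move=> /cpos[].
have Uc0 : U (c 0) by rewrite c0.
have [d /andP[d0 d1] dP] := near0_and (relatively_open_path oU rc cpos Uc0)
  (rational01_cvg0 (r2 _ cpol rc) gap).
have dd : 0 <= d <= d by rewrite lexx ltW.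
have [Ud] := dP _ dd; rewrite c0 ltr_norml => /andP[_ Jd].
apply: ninv; exists (c d), q; split; [|split; [|split]] => //; last by lra.
rewrite cJ ?d1 ?andbT ?ltW // -J1E; nra.
Qed.

(** Both paths start at [pi0] and end at equal [J1], so [J1] is the same affine function of time on
    each. *)
Lemma determines_pos_policy J1 J2 U pi0 :
  policy_rational J2 -> policy_linearizable J1 ->
  (forall pi, U pi -> is_pos_policy pi) -> relatively_open U -> U pi0 ->
  determines J1 J2 U -> determines J1 J2 (@is_pos_policy R S A).
Proof.
move=> r2 lin1 Upos oU U0 detU p q ppos qpos J1E.
have [c [c0 c1 cpos rc cJ]] := lin1 _ _ (Upos _ U0) ppos.
have [b [b0 b1 bpos rb bJ]] := lin1 _ _ (Upos _ U0) qpos.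
have [d d01 dP] : exists2 d, 0 < d <= 1 & forall t, 0 <= t <= d ->
    U (c t) /\ U (b t).
  by apply: near0_and; apply: relatively_open_path => //; rewrite ?c0 ?b0.
have cpol t : 0 <= t <= 1 -> is_policy (c t) by move=> /cpos[].
have bpol t : 0 <= t <= 1 -> is_policy (b t) by move=> /bpos[].
rewrite -c1 -b1.
apply: (rational01_identity (r2 _ cpol rc) (r2 _ bpol rb) d01); last first.
  by rewrite ler01 lexx.
move=> t td; have [Uc Ub] := dP _ td; apply: detU => //.
have t01 : 0 <= t <= 1.
  by move/andP: td d01 => [-> td] /andP[_ d1]; apply: le_trans td d1.
by rewrite cJ // bJ // J1E.
Qed.

(* If [J1 p = J1 q] but [J2 p < m < J2 q], then positive policies near [p] and
   [q], joined by a path along which [J1] is affine, give by the intermediate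
   value theorem positive policies where [J2 = m] and [J1] is as close to
   [J1 p] as desired; as [J2] determines [J1] there, [J1] equals [J1 p] at all
   of them. Two such values of [m] contradict that [J1] determines [J2]. *)
Lemma determines_policy J1 J2 pi0 :
  policy_rational J1 -> policy_rational J2 -> policy_linearizable J1 ->
  is_pos_policy pi0 ->
  determines J1 J2 (@is_pos_policy R S A) ->
  determines J2 J1 (@is_pos_policy R S A) ->
  determines J1 J2 (@is_policy R S A).
Proof.
move=> r1 r2 lin1 pos0 det12 det21.
suff lt_false p q : is_policy p -> is_policy q -> J1 p = J1 q -> J2 p < J2 q -> False.
  move=> p q ppol qpol J1E; apply/eqP.
  by case: ltgtP => // J2lt; [case: (lt_false p q)|case: (lt_false q p)].
move=> ppol qpol J1E J2lt.
have near m e : J2 p < m < J2 q -> 0 < e ->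
    exists2 x, is_pos_policy x & J2 x = m /\ `|J1 x - J1 p| < e.
  move=> /andP[pm mq] e0.
  (* The last two terms keep [m] between the [J2] values of the approximants, as the intermediate
     value theorem requires. *)
  have e'0 : 0 < Num.min e (Num.min (m - J2 p) (J2 q - m)).
    by rewrite !lt_min e0 !subr_gt0 pm.
  have [x xpos []] := pos_policy_approx r1 r2 ppol pos0 e'0.
  rewrite !lt_min => /and3P[x1 _ _] /and3P[_ x2 _].
  have [y ypos []] := pos_policy_approx r1 r2 qpol pos0 e'0.
  rewrite !lt_min => /and3P[y1 _ _] /and3P[_ _ y2].
  have [c [c0 c1 cpos rc cJ]] := lin1 _ _ xpos ypos.
  have cpol t : 0 <= t <= 1 -> is_policy (c t) by move=> /cpos[].
  have [|t t01 ct] := @rational01_ivt _ _ m (r2 _ cpol rc).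
    rewrite c0 c1; move: x2 y2; rewrite !ltr_norml => /andP[_ x2] /andP[y2 _].
    by apply/andP; split; lra.
  exists (c t); first exact: cpos.
  split=> //; rewrite cJ // ltr_norml.
  rewrite -J1E in y1; move: x1 y1; rewrite !ltr_norml => /andP[a1 a2] /andP[b1 b2].
  have lo : 0 < (1 - t) * (J1 x - J1 p + e) + t * (J1 y - J1 p + e).
    by apply: convex_comb_gt0 => //; lra.
  have hi : 0 < (1 - t) * (e - (J1 x - J1 p)) + t * (e - (J1 y - J1 p)).
    by apply: convex_comb_gt0 => //; lra.
  by apply/andP; split; lra.
(* Otherwise [near] gives [y] on the same level of [J2] with [J1] strictly closer to [J1 p], yet
   [J2] determines [J1]. *)
have eqc m x : J2 p < m < J2 q -> is_pos_policy x -> J2 x = m -> J1 x = J1 p.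
  move=> mpq xpos xm; apply/eqP; rewrite -subr_eq0 -normr_eq0; apply: contraT => ne.
  have e0 : 0 < `|J1 x - J1 p| by rewrite lt0r ne normr_ge0.
  have [y ypos [ym]] := near m _ mpq e0.
  by rewrite (det21 y x) ?ltxx // ym xm.
pose m := (J2 p + J2 q) / 2; pose n := (J2 p + m) / 2.
have mpq : J2 p < m < J2 q by rewrite /m; apply/andP; split; lra.
have npq : J2 p < n < J2 q by rewrite /n /m; apply/andP; split; lra.
have [x xpos [xm _]] := near m 1 mpq ltr01.
have [y ypos [yn _]] := near n 1 npq ltr01.
have := det12 x y xpos ypos; rewrite (eqc m) // (eqc n) // xm yn => /(_ erefl).
by rewrite /n /m; lra.
Qed.

(** * Conclusion *)

Lemma value_inversion_of_nonequivalent J1 J2 Pi :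
  policy_rational J1 -> policy_linearizable J1 ->
  policy_rational J2 -> policy_linearizable J2 ->
  (forall pi, Pi pi -> is_policy pi) -> contains_open_subset Pi ->
  ~ trivial_on J1 Pi -> ~ trivial_on J2 Pi -> ~ equivalent_on J1 J2 Pi ->
  value_inversion J1 J2 Pi.
Proof.
move=> r1 lin1 r2 lin2 hPi [U [[pi0 U0] [Upos [UPi oU]]]] nt1 nt2 neq.
apply: contrapT => ninv.
have pos0 := Upos _ U0.
have ninvU : ~ value_inversion J1 J2 U.
  by move=> [p [q [Up [Uq inv]]]]; apply: ninv; exists p, q; split; auto.
have ninvU' : ~ value_inversion J2 J1 U by move=> /value_inversionC.
have nt1' m := nontrivial_pos_policy m r1 hPi pos0 nt1.
have nt2' m := nontrivial_pos_policy m r2 hPi pos0 nt2.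
have det12 := determines_pos_policy r2 lin1 Upos oU U0
  (determines_open r2 lin1 Upos oU nt1' ninvU).
have det21 := determines_pos_policy r1 lin2 Upos oU U0
  (determines_open r1 lin2 Upos oU nt2' ninvU').
have det12' := determines_policy r1 r2 lin1 pos0 det12 det21.
have det21' := determines_policy r2 r1 lin2 pos0 det21 det12.
(* A failure of equivalence pairs a weak inequality with an opposite strict one; determination
   excludes equality in the weak one, leaving an inversion. *)
apply: neq => p q Pp Pq; split=> le; rewrite leNgt; apply/negP => lt; apply: ninv.
- exists p, q; split=> //; split=> //; split=> //; rewrite lt_neqAle le andbT.
  by apply: contraTneq lt => /(det12' q p (hPi _ Pq) (hPi _ Pp)) ->; rewrite ltxx.
- exists q, p; split=> //; split=> //; split=> //; rewrite lt_neqAle le andbT.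
  by apply: contraTneq lt => /(det21' q p (hPi _ Pq) (hPi _ Pp)) ->; rewrite ltxx.
Qed.

End Inversion.

Theorem mainTheorem10 (R : realType) (S A : finType) (hA : (1 < #|A|)%N)
    (gamma : R) (hg0 : 0 <= gamma) (hg1 : gamma < 1)
    (d0 : S -> R) (hd0 : is_distr d0)
    (Pi : (S -> A -> R) -> Prop)
    (hPi : forall pi, Pi pi -> is_policy pi)
    (hopen : contains_open_subset Pi) :
  (* case 1: two reward functions in a fixed environment *)
  (forall (T : S -> A -> S -> R) (R1 R2 : S -> A -> R),
     is_transition T -> all_reachable T d0 ->
     ~ trivial_on (value T d0 gamma R1) Pi ->
     ~ trivial_on (value T d0 gamma R2) Pi ->
     ~ equivalent_on (value T d0 gamma R1) (value T d0 gamma R2) Pi ->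
     value_inversion (value T d0 gamma R1) (value T d0 gamma R2) Pi)
  /\
  (* case 2: two transition models in a fixed task *)
  (forall (Rw : S -> A -> R) (T1 T2 : S -> A -> S -> R),
     is_transition T1 -> all_reachable T1 d0 ->
     is_transition T2 -> all_reachable T2 d0 ->
     ~ trivial_on (fun pi => value T1 d0 gamma Rw pi) Pi ->
     ~ trivial_on (fun pi => value T2 d0 gamma Rw pi) Pi ->
     ~ equivalent_on (fun pi => value T1 d0 gamma Rw pi)
                     (fun pi => value T2 d0 gamma Rw pi) Pi ->
     value_inversion (fun pi => value T1 d0 gamma Rw pi)
                     (fun pi => value T2 d0 gamma Rw pi) Pi).
Proof.
have d0_ge0 := hd0.1.
split=> [T R1 R2 T_tr _ nt1 nt2 neq|Rw T1 T2 T1_tr _ T2_tr _ nt1 nt2 neq];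
  (* Each value function is rational and linearizable in its own environment, so both cases are
     instances of the abstract result. *)
  apply: value_inversion_of_nonequivalent => //;
  by [exact: rational01_value|exact: value_affine_path].
Qed.
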